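(* For any $n>0$ and $\chi\in\mathbb{Z}^n$, the element $$\mathbf{w}(\chi)=\sum_{\sigma\in\mathrm{Sym}(n)}\mathrm{sgn}(\sigma)\prod_{1\leq i\leq n} f(\chi_i+\sigma(i))\,u_0\in\mathbf{M}_n$$ is a singular vector.
   Context: Let $\mathbb{k}$ be a field of characteristic zero. Let $\mathrm{sl}(2)$ be the Lie algebra over $\mathbb{k}$ with basis $e,f,h$ and $[e,f]=h$, $[h,e]=2e$, $[h,f]=-2f$. Let $\mathfrak{g}=\mathrm{sl}(2)\otimes\mathbb{k}[t^{\pm1}]$ be the loop algebra, with $x(k)=x\otimes t^k$ and $[x(k),y(l)]=[x,y](k+l)$. Put $\mathcal{E}=\bigoplus_{j\in\mathbb{Z}}\mathbb{k}e(j)$, $\mathcal{H}=\bigoplus_{j\in\mathbb{Z}}\mathbb{k}h(j)$, $\mathcal{F}=\bigoplus_{j\in\mathbb{Z}}\mathbb{k}f(j)$. Let $\mathbf{M}(0)=\mathrm{Ind}_{\mathcal{H}\oplus\mathcal{E}}^{\mathfrak{g}}\,\mathbb{k}u_0$ be the $\mathfrak{g}$-module induced from the one-dimensional module $\mathbb{k}u_0$ with $(\mathcal{H}\oplus\mathcal{E})\cdot u_0=0$. For $n\geq 0$, $\mathbf{M}_n=\{v\in\mathbf{M}(0): h(0)v=-2nv\}$ is the $n$-th layer. An element $v\in\mathbf{M}(0)$ is called singular if $\mathcal{E}\cdot v=0$. *)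

(* Defs.v *)
From HB Require Import structures.
From mathcomp Require Import all_boot perm all_order all_algebra.
From mathcomp Require Import ring boolp finmap monalg.

Set Implicit Arguments.
Unset Strict Implicit.
Unset Printing Implicit Defensive.

Import GRing.Theory.
Local Open Scope ring_scope.
Local Open Scope quotient_scope.

Section Span.
Variables (K : fieldType) (V : lmodType K).

Inductive span (S : V -> Prop) : V -> Prop :=
| span0 : span S 0
| spanZD c x y : S x -> span S y -> span S (c *: x + y).

Variable S : V -> Prop.

Lemma span_gen x : S x -> span S x.
Proof. by move=> Sx; rewrite -[x]addr0 -[x]scale1r; exact/spanZD/span0. Qed.

Lemma spanD x y : span S x -> span S y -> span S (x + y).
Proof.
by elim=> [|c u v Su _ IH] Sy; rewrite ?add0r // -addrA; apply/spanZD/IH.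
Qed.

Lemma spanZ c x : span S x -> span S (c *: x).
Proof.
elim=> [|d u v Su _ IH]; first by rewrite scaler0; exact: span0.
by rewrite scalerDr scalerA; exact: spanZD.
Qed.

Definition span_pred : V -> bool := fun x => `[< span S x >].

Lemma span_pred_zmod_closed : zmod_closed span_pred.
Proof.
split=> [|x y]; first exact/asboolP/span0.
move=> /asboolP Sx /asboolP Sy; apply/asboolP.
by rewrite -scaleN1r; apply/spanD/spanZ.
Qed.

HB.instance Definition _ := GRing.isZmodClosed.Build V span_pred
  span_pred_zmod_closed.

Definition span_zmod : zmodClosed V := GRing.ZmodClosed.clone V span_pred _.

Definition quotmod := Quotient.quot span_zmod.
HB.instance Definition _ := GRing.Zmodule.on quotmod.
Definition qpi : V -> quotmod := \pi_(Quotient.quot span_zmod).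
Definition qrepr : quotmod -> V := repr.

Lemma qreprK : cancel qrepr qpi. Proof. exact: reprK. Qed.

Lemma qpiP x y : qpi x = qpi y <-> span S (x - y).
Proof.
split=> [/eqP|] h; first by move: h; rewrite -Quotient.idealrBE => /asboolP.
by apply/eqP; rewrite -Quotient.idealrBE; apply/asboolP.
Qed.

Lemma qpi_repr x : span S (qrepr (qpi x) - x).
Proof. by apply/qpiP; rewrite qreprK. Qed.

Lemma qpiD x y : qpi (x + y) = qpi x + qpi y.
Proof. exact: Quotient.pi_add. Qed.

Definition scaleq c (x : quotmod) : quotmod := qpi (c *: qrepr x).

Lemma qpiZ_ c x : qpi (c *: x) = scaleq c (qpi x).
Proof.
apply/esym/qpiP; rewrite -scalerBr; exact/spanZ/qpi_repr.
Qed.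

Lemma scaleqA a b x : scaleq a (scaleq b x) = scaleq (a * b) x.
Proof. by rewrite -[x]qreprK -!qpiZ_ scalerA. Qed.
Lemma scaleq1 : left_id 1 scaleq.
Proof. by move=> x; rewrite -[x]qreprK -qpiZ_ scale1r. Qed.
Lemma scaleqDr : right_distributive scaleq +%R.
Proof.
by move=> a x y; rewrite -[x]qreprK -[y]qreprK -!(qpiZ_, qpiD) scalerDr.
Qed.
Lemma scaleqDl x : {morph scaleq^~ x : a b / a + b}.
Proof. by move=> a b; rewrite -[x]qreprK -!(qpiZ_, qpiD) scalerDl. Qed.

HB.instance Definition _ := GRing.Zmodule_isLmodule.Build K quotmod
  scaleqA scaleq1 scaleqDr scaleqDl.

Lemma qpi_is_linear : linear qpi.
Proof. by move=> c x y; rewrite qpiD qpiZ_. Qed.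
HB.instance Definition _ := GRing.isLinear.Build K V quotmod _ qpi
  qpi_is_linear.

Lemma qpi0 x : span S x -> qpi x = 0.
Proof. by move=> Sx; rewrite -(raddf0 qpi); apply/qpiP; rewrite subr0. Qed.

End Span.

Lemma span_linear (K : fieldType) (V W : lmodType K) (S : V -> Prop)
    (T : W -> Prop) (f : {linear V -> W}) :
  (forall x, S x -> span T (f x)) -> forall x, span S x -> span T (f x).
Proof.
move=> ST x; elim=> [|c u v Su _ IH]; first by rewrite raddf0; exact: span0.
by rewrite linearP; apply/spanD/IH/spanZ/ST.
Qed.

Section MalgExtension.
Variables (I : choiceType) (G V : zmodType).

Definition mext (f : I -> G -> V) (g : {malg G[I]}) : V :=
  \sum_(i <- msupp g) f i g@_i.

Lemma malg_ind (P : {malg G[I]} -> Prop) : P 0 ->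
  (forall g1 g2, P g1 -> P g2 -> P (g1 + g2)) ->
  (forall i x, P << x *g i >>) -> forall g, P g.
Proof. by move=> P0 PD PU g; rewrite [g]monalgE; apply: big_ind. Qed.

Variable f : I -> G -> V.
Hypothesis fD : forall i, {morph f i : x y / x + y}.

Let f0 i : f i 0 = 0.
Proof. by apply: (@addrI _ (f i 0)); rewrite -fD !addr0. Qed.

Lemma mextw (d : {fset I}) g : (msupp g `<=` d)%fset ->
  mext f g = \sum_(i <- d) f i g@_i.
Proof.
by move=> le; rewrite /mext (big_fset_incl _ le) //= => i _ /mcoeff_outdom ->.
Qed.

Lemma mextU i x : mext f << x *g i >> = f i x.
Proof. by rewrite (mextw msuppU_le) big_seq_fset1 mcoeffUU. Qed.

Lemma mextD : {morph mext f : g1 g2 / g1 + g2}.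
Proof.
move=> g1 g2; pose d := (msupp g1 `|` msupp g2)%fset.
rewrite (mextw (msuppD_le _ _)) (@mextw d g1) ?fsubsetUl //.
rewrite (@mextw d g2) ?fsubsetUr // -big_split.
by apply: eq_bigr => i _; rewrite mcoeffD fD.
Qed.

End MalgExtension.

Section LinearExtension.
Variables (K : fieldType) (I : choiceType) (V : lmodType K) (F : I -> V).

Definition mlin (g : {malg K[I]}) : V := mext (fun i c => c *: F i) g.

Let FD i : {morph (fun c => c *: F i) : c d / c + d}.
Proof. by move=> c d; rewrite scalerDl. Qed.

Lemma mlinU c i : mlin << c *g i >> = c *: F i. Proof. exact: mextU. Qed.

Lemma mlin_is_linear : linear mlin.
Proof.
move=> c g1 g2; rewrite /mlin mextD //; congr (_ + _).
rewrite (mextw FD (msuppZ_le _ _)) scaler_sumr.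
by apply: eq_bigr => i _; rewrite mcoeffZ scalerA.
Qed.
HB.instance Definition _ := GRing.isLinear.Build K {malg K[I]} V _ mlin
  mlin_is_linear.

End LinearExtension.

Section QuotientAlgebra.
Variables (K : fieldType) (A : algType K) (S : A -> Prop).

(* The linear span of this set is the two-sided ideal generated by S. *)
Inductive ideal_gen : A -> Prop :=
| Ideal_gen a s b : S s -> ideal_gen (a * s * b).

Definition quotalg of ~ span ideal_gen 1 := quotmod ideal_gen.

Hypothesis nz : ~ span ideal_gen 1.
Local Notation Q := (quotalg nz).

HB.instance Definition _ := GRing.Lmodule.on Q.

Definition qapi (a : A) : Q := qpi ideal_gen a.

Let qapi_repr (x : Q) : {a | x = qapi a}.
Proof. by exists (qrepr x); rewrite /qapi qreprK. Qed.

Lemma qapi_linear : linear qapi. Proof. exact: qpi_is_linear. Qed.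
HB.instance Definition _ := GRing.isLinear.Build K A Q _ qapi qapi_linear.

Lemma ideal_mulr a x : span ideal_gen x -> span ideal_gen (a * x).
Proof.
elim=> [|c u v [b r d Er] _ IH]; first by rewrite mulr0; exact: span0.
by rewrite mulrDr -scalerAr !mulrA; apply: spanZD IH.
Qed.

Lemma ideal_mull a x : span ideal_gen x -> span ideal_gen (x * a).
Proof.
elim=> [|c u v [b r d Er] _ IH]; first by rewrite mul0r; exact: span0.
by rewrite mulrDl -scalerAl -[b * r * d * a]mulrA; apply: spanZD IH.
Qed.

Definition quotalg_one : Q := qapi 1.
Definition quotalg_mul (x y : Q) : Q := qapi (qrepr x * qrepr y).

Let piM a b : quotalg_mul (qapi a) (qapi b) = qapi (a * b).
Proof.
apply/qpiP; set a' := qrepr _; set b' := qrepr _.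
have -> : a' * b' - a * b = (a' - a) * b' + a * (b' - b).
  by rewrite mulrBl mulrBr addrA subrK.
by apply: spanD; [apply/ideal_mull/qpi_repr|apply/ideal_mulr/qpi_repr].
Qed.

Let q_mulA : associative quotalg_mul.
Proof.
move=> x y z; have [a ->] := qapi_repr x; have [b ->] := qapi_repr y.
have [c ->] := qapi_repr z.
by rewrite !piM mulrA.
Qed.
Let q_mul1l : left_id quotalg_one quotalg_mul.
Proof. by move=> x; have [a ->] := qapi_repr x; rewrite piM mul1r. Qed.
Let q_mul1r : right_id quotalg_one quotalg_mul.
Proof. by move=> x; have [a ->] := qapi_repr x; rewrite piM mulr1. Qed.
Let q_mulDl : left_distributive quotalg_mul +%R.
Proof.
move=> x y z; have [a ->] := qapi_repr x; have [b ->] := qapi_repr y.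
have [c ->] := qapi_repr z.
by rewrite -raddfD !piM -raddfD mulrDl.
Qed.
Let q_mulDr : right_distributive quotalg_mul +%R.
Proof.
move=> x y z; have [a ->] := qapi_repr x; have [b ->] := qapi_repr y.
have [c ->] := qapi_repr z.
by rewrite -raddfD !piM -raddfD mulrDr.
Qed.
Let q_one_neq0 : quotalg_one != 0.
Proof.
by apply/eqP; rewrite -(raddf0 qapi) => /qpiP; rewrite subr0.
Qed.

HB.instance Definition _ := GRing.Zmodule_isNzRing.Build Q
  q_mulA q_mul1l q_mul1r q_mulDl q_mulDr q_one_neq0.

Lemma qapiM a b : qapi (a * b) = qapi a * qapi b.
Proof. by rewrite -piM. Qed.

Let scaleAl (c : K) (x y : Q) : c *: (x * y) = (c *: x) * y.
Proof.
have [a ->] := qapi_repr x; have [b ->] := qapi_repr y.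
by rewrite -qapiM -linearZ /= -linearZ /= -qapiM scalerAl.
Qed.
HB.instance Definition _ := GRing.Lmodule_isLalgebra.Build K Q scaleAl.

Let scaleAr (c : K) (x y : Q) : c *: (x * y) = x * (c *: y).
Proof.
have [a ->] := qapi_repr x; have [b ->] := qapi_repr y.
by rewrite -qapiM -linearZ /= -linearZ /= -qapiM scalerAr.
Qed.
HB.instance Definition _ := GRing.Lalgebra_isAlgebra.Build K Q scaleAr.

Lemma qapi_rel a b s : S s -> a - b = s -> qapi a = qapi b.
Proof.
move=> Ss Eab; apply/qpiP; rewrite Eab -[s]mulr1 -[s]mul1r.
exact/span_gen/Ideal_gen.
Qed.

End QuotientAlgebra.

Section Augmentation.
Variables (K : fieldType) (A : algType K) (aug : A -> K).
Hypothesis augP : forall c a b, aug (c *: a + b) = c * aug a + aug b.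
Hypothesis augM : {morph aug : a b / a * b}.

Let augB a b : aug (a - b) = aug a - aug b.
Proof. by rewrite addrC -scaleN1r augP mulN1r addrC. Qed.

Let aug0 : aug 0 = 0.
Proof. by rewrite -(subrr 0) augB subrr. Qed.

Lemma aug_lin c a b d : aug (a - c *: b - d) = aug a - c * aug b - aug d.
Proof. by rewrite !augB -[c *: b]addr0 augP aug0 addr0. Qed.

Lemma aug_comm a b c : aug (a * b - b * a - c) = - aug c.
Proof. by rewrite !augB !augM [aug b * _]mulrC subrr sub0r. Qed.

Lemma ideal_gen_proper (S : A -> Prop) : aug 1 = 1 ->
  (forall s, S s -> aug s = 0) -> ~ span (ideal_gen S) 1.
Proof.
move=> aug1 augS.
suff h x : span (ideal_gen S) x -> aug x = 0.
  by move=> /h /eqP; rewrite aug1 oner_eq0.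
elim=> [//|c u v [a s b /augS Es] _ IH].
by rewrite augP IH !augM Es mulr0 mul0r mulr0 addr0.
Qed.

End Augmentation.

HB.mixin Record Lmodule_isLie (K : fieldType) L of GRing.Lmodule K L := {
  lie : L -> L -> L;
  lie_linearl : forall z c x y, lie (c *: x + y) z = c *: lie x z + lie y z;
  lie_linearr : forall z c x y, lie z (c *: x + y) = c *: lie z x + lie z y;
  liexx : forall x, lie x x = 0;
  jacobi : forall x y z,
    lie x (lie y z) + lie y (lie z x) + lie z (lie x y) = 0
}.

#[short(type="lieType")]
HB.structure Definition Lie (K : fieldType) :=
  {L of GRing.Lmodule K L & Lmodule_isLie K L}.

Notation "[lie x , y ]" := (lie x y)
  (at level 0, x, y at level 99, format "[lie  x ,  y ]") : ring_scope.

Section LieTheory.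
Variables (K : fieldType) (L : lieType K).
Implicit Types x y z : L.

Lemma lieDl x y z : [lie x + y, z] = [lie x, z] + [lie y, z].
Proof. by rewrite -[x]scale1r lie_linearl !scale1r. Qed.
Lemma lieDr x y z : [lie z, x + y] = [lie z, x] + [lie z, y].
Proof. by rewrite -[x]scale1r lie_linearr !scale1r. Qed.
Lemma lie0l z : [lie 0, z] = 0 :> L.
Proof. by apply: (@addrI _ [lie 0, z]); rewrite -lieDl !addr0. Qed.
Lemma lie0r z : [lie z, 0] = 0 :> L.
Proof. by apply: (@addrI _ [lie z, 0]); rewrite -lieDr !addr0. Qed.
Lemma lieZl c x z : [lie c *: x, z] = c *: [lie x, z].
Proof. by rewrite -[c *: x]addr0 lie_linearl lie0l addr0. Qed.
Lemma lieZr c x z : [lie z, c *: x] = c *: [lie z, x].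
Proof. by rewrite -[c *: x]addr0 lie_linearr lie0r addr0. Qed.
Lemma lieC x y : [lie x, y] = - [lie y, x].
Proof.
apply/eqP; rewrite -addr_eq0; apply/eqP.
by have := liexx (x + y); rewrite lieDl !lieDr !liexx add0r addr0.
Qed.

End LieTheory.

(* Coordinates are taken with respect to the basis e, f, h, in this order. *)
Definition sl2 (K : fieldType) := 'rV[K]_3.

Section Sl2.
Variable K : fieldType.

HB.instance Definition _ := GRing.Lmodule.on (sl2 K).

Definition sl2e : sl2 K := 'e_0.
Definition sl2f : sl2 K := 'e_1.
Definition sl2h : sl2 K := 'e_2%:R.

Definition sl2_lie (x y : sl2 K) : sl2 K :=
  let: (xe, xf, xh) := (x 0 0, x 0 1, x 0 2%:R) in
  let: (ye, yf, yh) := (y 0 0, y 0 1, y 0 2%:R) in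
  (2 * (xh * ye - xe * yh)) *: sl2e - (2 * (xh * yf - xf * yh)) *: sl2f
  + (xe * yf - xf * ye) *: sl2h.

Lemma sl2P (x y : sl2 K) : x 0 0 = y 0 0 -> x 0 1 = y 0 1 ->
  x 0 2%:R = y 0 2%:R -> x = y.
Proof.
move=> h0 h1 h2; apply/rowP=> -[[|[|[|//]]] lti].
- by move: h0; congr (x _ _ = y _ _); apply/val_inj.
- by move: h1; congr (x _ _ = y _ _); apply/val_inj.
- by move: h2; congr (x _ _ = y _ _); apply/val_inj.
Qed.

Lemma sl2_lie_linearl z c x y :
  sl2_lie (c *: x + y) z = c *: sl2_lie x z + sl2_lie y z.
Proof. by apply: sl2P; rewrite !mxE /=; ring. Qed.

Lemma sl2_lie_linearr z c x y :
  sl2_lie z (c *: x + y) = c *: sl2_lie z x + sl2_lie z y.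
Proof. by apply: sl2P; rewrite !mxE /=; ring. Qed.

Lemma sl2_liexx x : sl2_lie x x = 0.
Proof. by apply: sl2P; rewrite !mxE /=; ring. Qed.

Lemma sl2_jacobi x y z :
  sl2_lie x (sl2_lie y z) + sl2_lie y (sl2_lie z x) + sl2_lie z (sl2_lie x y)
  = 0.
Proof. by apply: sl2P; rewrite !mxE /=; ring. Qed.

HB.instance Definition _ := Lmodule_isLie.Build K (sl2 K)
  sl2_lie_linearl sl2_lie_linearr sl2_liexx sl2_jacobi.

Lemma sl2_lie_ef : [lie sl2e, sl2f] = sl2h.
Proof. by apply: sl2P; rewrite !mxE /=; ring. Qed.
Lemma sl2_lie_he : [lie sl2h, sl2e] = 2 *: sl2e.
Proof. by apply: sl2P; rewrite !mxE /=; ring. Qed.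
Lemma sl2_lie_hf : [lie sl2h, sl2f] = - 2 *: sl2f.
Proof. by apply: sl2P; rewrite !mxE /=; ring. Qed.

End Sl2.

(* An element of L (x) k[t, t^-1] is a finite sum of x_i (x) t^i, that is, a
   finitely supported family (x_i), i : int, of elements of L. *)
Definition loop (K : fieldType) (L : lieType K) := {malg L[int]}.

Section Loop.
Variables (K : fieldType) (L : lieType K).

HB.instance Definition _ := GRing.Zmodule.on (loop L).

Definition tpow (x : L) (i : int) : loop L := << x *g i >>.

Lemma tpowD x y i : tpow (x + y) i = tpow x i + tpow y i.
Proof. exact: monalgUD. Qed.

Lemma loop_ind (P : loop L -> Prop) : P 0 ->
  (forall u v, P u -> P v -> P (u + v)) ->
  (forall x i, P (tpow x i)) -> forall u, P u.
Proof. by move=> P0 PD PU; apply: malg_ind => // i x; exact: PU. Qed.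

Definition loop_scale (c : K) (u : loop L) : loop L :=
  [malg i in msupp u => c *: u@_i].

Lemma loop_scaleE c u i : (loop_scale c u)@_i = c *: u@_i.
Proof. by rewrite mcoeffE; case: msuppP; rewrite ?scaler0. Qed.

Lemma loop_scaleA a b u : loop_scale a (loop_scale b u) = loop_scale (a * b) u.
Proof. by apply/malgP => i; rewrite !loop_scaleE scalerA. Qed.
Lemma loop_scale1 : left_id 1 loop_scale.
Proof. by move=> u; apply/malgP => i; rewrite loop_scaleE scale1r. Qed.
Lemma loop_scaleDr : right_distributive loop_scale +%R.
Proof.
by move=> a u v; apply/malgP => i; rewrite !(loop_scaleE, mcoeffD) scalerDr.
Qed.
Lemma loop_scaleDl u : {morph loop_scale^~ u : a b / a + b}.
Proof.
by move=> a b; apply/malgP => i; rewrite !(loop_scaleE, mcoeffD) scalerDl.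
Qed.

HB.instance Definition _ := GRing.Zmodule_isLmodule.Build K (loop L)
  loop_scaleA loop_scale1 loop_scaleDr loop_scaleDl.

Lemma tpowZ c x i : tpow (c *: x) i = c *: tpow x i.
Proof.
apply/malgP => j; rewrite /tpow mcoeffU loop_scaleE mcoeffU.
by case: eqP; rewrite ?scaler0.
Qed.

Definition loop_lie (u v : loop L) : loop L :=
  mext (fun i x => mext (fun j y => tpow [lie x, y] (i + j)) v) u.

Let brD i j x : {morph (fun y => tpow [lie x, y] (i + j)) : y z / y + z}.
Proof. by move=> y z; rewrite lieDr tpowD. Qed.

Let br2D v i : {morph (fun x => mext (fun j y => tpow [lie x, y] (i + j)) v) :
  x y / x + y}.
Proof.
move=> x y; rewrite /mext -big_split; apply: eq_bigr => j _ /=.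
by rewrite lieDl tpowD.
Qed.

Let loop_lieDl u v w : loop_lie (u + v) w = loop_lie u w + loop_lie v w.
Proof. exact: mextD. Qed.

Let loop_lieDr u v w : loop_lie w (u + v) = loop_lie w u + loop_lie w v.
Proof.
rewrite -[RHS]big_split; apply: eq_bigr => i _; exact: mextD.
Qed.

Let loop_lie_tpow x y i j :
  loop_lie (tpow x i) (tpow y j) = tpow [lie x, y] (i + j).
Proof. by rewrite /loop_lie !mextU. Qed.

Let loop_lie0l w : loop_lie 0 w = 0.
Proof. by apply: (@addrI _ (loop_lie 0 w)); rewrite -loop_lieDl !addr0. Qed.
Let loop_lie0r w : loop_lie w 0 = 0.
Proof. by apply: (@addrI _ (loop_lie w 0)); rewrite -loop_lieDr !addr0. Qed.

Lemma loop_lie_linearl w c u v :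
  loop_lie (c *: u + v) w = c *: loop_lie u w + loop_lie v w.
Proof.
rewrite loop_lieDl; congr (_ + _); elim/loop_ind: u.
- by rewrite scaler0 loop_lie0l scaler0.
- by move=> u1 u2 e1 e2; rewrite scalerDr !loop_lieDl e1 e2 scalerDr.
move=> x i; elim/loop_ind: w.
- by rewrite !loop_lie0r scaler0.
- by move=> u1 u2 e1 e2; rewrite !loop_lieDr e1 e2 scalerDr.
by move=> y j; rewrite -tpowZ !loop_lie_tpow lieZl tpowZ.
Qed.

Lemma loop_lie_linearr w c u v :
  loop_lie w (c *: u + v) = c *: loop_lie w u + loop_lie w v.
Proof.
rewrite loop_lieDr; congr (_ + _); elim/loop_ind: u.
- by rewrite scaler0 loop_lie0r scaler0.
- by move=> u1 u2 e1 e2; rewrite scalerDr !loop_lieDr e1 e2 scalerDr.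
move=> x i; elim/loop_ind: w.
- by rewrite !loop_lie0l scaler0.
- by move=> u1 u2 e1 e2; rewrite !loop_lieDl e1 e2 scalerDr.
by move=> y j; rewrite -tpowZ !loop_lie_tpow lieZr tpowZ.
Qed.

Let loop_lieC u v : loop_lie u v + loop_lie v u = 0.
Proof.
elim/loop_ind: u.
- by rewrite loop_lie0l loop_lie0r addr0.
- by move=> u1 u2 e1 e2; rewrite loop_lieDl loop_lieDr addrACA e1 e2 addr0.
move=> x i; elim/loop_ind: v.
- by rewrite loop_lie0l loop_lie0r addr0.
- by move=> u1 u2 e1 e2; rewrite loop_lieDl loop_lieDr addrACA e1 e2 addr0.
move=> y j; rewrite !loop_lie_tpow [j + i]addrC -tpowD (lieC y x) subrr.
by rewrite /tpow monalgU0.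
Qed.

Lemma loop_liexx u : loop_lie u u = 0.
Proof.
elim/loop_ind: u; first exact: loop_lie0l.
  move=> u v eu ev.
  by rewrite loop_lieDl !loop_lieDr eu ev add0r addr0 loop_lieC.
by move=> x i; rewrite loop_lie_tpow liexx /tpow monalgU0.
Qed.

Lemma loop_jacobi u v w : loop_lie u (loop_lie v w)
  + loop_lie v (loop_lie w u) + loop_lie w (loop_lie u v) = 0.
Proof.
have J3 (A B C A' B' C' : loop L) : A + B + C = 0 -> A' + B' + C' = 0 ->
  (A + A') + (B + B') + (C + C') = 0.
  by move=> e e'; rewrite (addrACA A) (addrACA (A + B)) e e' addr0.
elim/loop_ind: u.
- by rewrite !(loop_lie0l, loop_lie0r) !addr0.
- by move=> u1 u2 e1 e2; rewrite !(loop_lieDl, loop_lieDr); exact: J3.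
move=> x i; elim/loop_ind: v.
- by rewrite !(loop_lie0l, loop_lie0r) !addr0.
- by move=> u1 u2 e1 e2; rewrite !(loop_lieDl, loop_lieDr); exact: J3.
move=> y j; elim/loop_ind: w.
- by rewrite !(loop_lie0l, loop_lie0r) !addr0.
- by move=> u1 u2 e1 e2; rewrite !(loop_lieDl, loop_lieDr); exact: J3.
move=> z k; rewrite !loop_lie_tpow.
have -> : j + (k + i) = i + (j + k) by rewrite addrA addrC.
have -> : k + (i + j) = i + (j + k) by rewrite addrC addrA.
by rewrite -!tpowD jacobi /tpow monalgU0.
Qed.

HB.instance Definition _ := Lmodule_isLie.Build K (loop L)
  loop_lie_linearl loop_lie_linearr loop_liexx loop_jacobi.

Lemma lie_tpow x y i j : [lie tpow x i, tpow y j] = tpow [lie x, y] (i + j).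
Proof. exact: loop_lie_tpow. Qed.

End Loop.

(* The free associative algebra on the underlying set of X. *)
Definition freealg (K : fieldType) (X : choiceType) := {malg K[{fmonom X}]}.

Section FreeAlgebra.
Variables (K : fieldType) (X : choiceType).

HB.instance Definition _ := GRing.Lalgebra.on (freealg K X).

Let malg_scalerAr (c : K) (x y : {malg K[{fmonom X}]}) :
  c *: (x * y) = x * (c *: y).
Proof.
have xC : x * malgC c = c *: x.
  apply/malgP => m; rewrite mcoeffZ malgM_def fgmulgU raddf_sum.
  rewrite [in RHS](monalgE x) raddf_sum mulr_sumr; apply: eq_bigr => m' _ /=.
  by rewrite !mcoeffU mulm1 mulrnAr [c * _]mulrC.
by rewrite -(mul_malgC c y) mulrA xC scalerAl.
Qed.

Lemma freealg_scalerAr (c : K) (x y : freealg K X) :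
  c *: (x * y) = x * (c *: y).
Proof. exact: malg_scalerAr. Qed.
HB.instance Definition _ := GRing.Lalgebra_isAlgebra.Build K (freealg K X)
  freealg_scalerAr.

Definition freegen (x : X) : freealg K X := << fmu x >>.

End FreeAlgebra.

Section Enveloping.
Variables (K : fieldType) (L : lieType K).

Local Notation T := (freealg K L).
Local Notation gen := (@freegen K L).

Inductive env_rel : T -> Prop :=
| env_linear c x y : env_rel (gen (c *: x + y) - c *: gen x - gen y)
| env_lie x y : env_rel (gen x * gen y - gen y * gen x - gen [lie x, y]).

Let aug : T -> K := @mcoeff {fmonom L} K mone.

Let aug_gen x : aug (gen x) = 0.
Proof.
rewrite /aug mcoeffU; case: eqP => // /(congr1 (@fmonom_val _)).
by rewrite fmuE fm1.
Qed.

Let augM : {morph aug : a b / a * b}.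
Proof. exact: (rmorphM (@mcoeff {fmonom L} K mone)). Qed.
Let augP c a b : aug (c *: a + b) = c * aug a + aug b.
Proof. by rewrite /aug mcoeffD mcoeffZ. Qed.

Let aug_rel r : env_rel r -> aug r = 0.
Proof.
case=> [d y z|y z].
  by rewrite (aug_lin augP) !aug_gen mulr0 !subr0.
by rewrite (aug_comm augP augM) aug_gen oppr0.
Qed.

Lemma env_rel_proper : ~ span (ideal_gen env_rel) 1.
Proof.
apply: (ideal_gen_proper augP augM) aug_rel.
by rewrite /aug mcoeff1 eqxx.
Qed.

Definition env := quotalg env_rel_proper.
HB.instance Definition _ := GRing.Algebra.on env.

Definition env_in (x : L) : env := qapi env_rel_proper (gen x).

Lemma env_in_is_linear : linear env_in.
Proof.
move=> c x y; rewrite /env_in -linearP.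
by apply: qapi_rel (env_linear c x y) _; rewrite opprD addrA.
Qed.
HB.instance Definition _ := GRing.isLinear.Build K L env _ env_in env_in_is_linear.

Lemma env_in_lie x y : env_in [lie x, y] = env_in x * env_in y - env_in y * env_in x.
Proof.
rewrite /env_in -!qapiM -raddfB; apply/esym.
exact: qapi_rel (env_lie x y) _.
Qed.

End Enveloping.

(* The tensor product A (x) N balanced over the elements j x of A, for x in b,
   which act on N through rho: the quotient of the free K-module on A x N by
   the relations of bilinearity and balancing. *)
Section BalancedTensor.
Variables (K : fieldType) (A : algType K) (L : Type) (j : L -> A).
Variables (N : lmodType K) (b : L -> Prop) (rho : L -> N -> N).

Local Notation F := {malg K[(A * N)%type]}.
Local Notation "<( u , n )>" := (<< ((u, n) : A * N) >> : F).

Inductive btens_rel : F -> Prop :=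
| btens_linl c u v n : btens_rel (<(c *: u + v, n)> - (c *: <(u, n)> + <(v, n)>))
| btens_linr u c m n : btens_rel (<(u, c *: m + n)> - (c *: <(u, m)> + <(u, n)>))
| btens_bal u x n : b x -> btens_rel (<(u * j x, n)> - <(u, rho x n)>).

Definition btens := quotmod btens_rel.
HB.instance Definition _ := GRing.Lmodule.on btens.

Definition tens (u : A) (n : N) : btens := qpi btens_rel <(u, n)>.

Lemma tens_linl c u v n : tens (c *: u + v) n = c *: tens u n + tens v n.
Proof.
by rewrite /tens -linearP; apply/qpiP/span_gen; exact: btens_linl.
Qed.

Lemma tens_linr u c m n : tens u (c *: m + n) = c *: tens u m + tens u n.
Proof.
by rewrite /tens -linearP; apply/qpiP/span_gen; exact: btens_linr.
Qed.

Lemma tens_bal u x n : b x -> tens (u * j x) n = tens u (rho x n).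
Proof. by move=> bx; apply/qpiP/span_gen; exact: btens_bal. Qed.

Definition free_act (u : A) : F -> F :=
  mlin (fun p : A * N => <(u * p.1, p.2)>).
Let free_act_is_linear u : linear (free_act u).
Proof. exact: mlin_is_linear. Qed.
HB.instance Definition _ u := GRing.isLinear.Build K F F _ (free_act u)
  (free_act_is_linear u).

Definition btens_act (u : A) (m : btens) : btens :=
  qpi btens_rel (free_act u (qrepr m)).

Let free_actE u v n : free_act u <(v, n)> = <(u * v, n)>.
Proof. by rewrite /free_act mlinU scale1r. Qed.

Let free_act_lin u c x y z : free_act u (x - (c *: y + z)) =
  free_act u x - (c *: free_act u y + free_act u z).
Proof. by rewrite raddfB /= linearP. Qed.

Let free_act_rel u x : span btens_rel x -> span btens_rel (free_act u x).
Proof.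
apply: (@span_linear _ _ _ _ _ (free_act u)) => _ [c v w n|v c n n'|v y n b_y];
  apply: span_gen.
- rewrite /= free_act_lin !free_actE mulrDr -scalerAr; exact: btens_linl.
- rewrite /= free_act_lin !free_actE; exact: btens_linr.
- rewrite raddfB /= !free_actE mulrA; exact: btens_bal.
Qed.

Let btens_act_pi u x : btens_act u (qpi btens_rel x) = qpi btens_rel (free_act u x).
Proof.
by apply/qpiP; rewrite -raddfB; apply/free_act_rel/qpi_repr.
Qed.

Lemma btens_act_tens u v n : btens_act u (tens v n) = tens (u * v) n.
Proof. by rewrite /tens btens_act_pi free_actE. Qed.

Lemma btens_act_is_linear u : linear (btens_act u).
Proof.
move=> c m n; rewrite -[m]qreprK -[n]qreprK -linearP !btens_act_pi.
by rewrite !linearP.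
Qed.
HB.instance Definition _ u := GRing.isLinear.Build K btens btens _ (btens_act u)
  (btens_act_is_linear u).

Lemma btens_ind (P : btens -> Prop) : P 0 ->
  (forall c u n m, P m -> P (c *: tens u n + m)) -> forall m, P m.
Proof.
move=> P0 PS m; rewrite -[m]qreprK [qrepr m]monalgE.
elim: (enum_fset _) => [|[u n] s IH]; first by rewrite big_nil raddf0.
rewrite big_cons.
have -> : << (qrepr m)@_(u, n) *g (u, n) >> = (qrepr m)@_(u, n) *: <(u, n)>.
  by apply/malgP => i; rewrite mcoeffZ !mcoeffU mulr_natr.
by rewrite linearP; exact: PS.
Qed.

Lemma btens_act_linl m c u v :
  btens_act (c *: u + v) m = c *: btens_act u m + btens_act v m.
Proof.
elim/btens_ind: m => [|d w n m IH]; first by rewrite !raddf0 addr0.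
rewrite !linearP /= IH !btens_act_tens mulrDl -scalerAl tens_linl.
rewrite !scalerDr !scalerA [d * c]mulrC !addrA; congr (_ + _).
by rewrite -!addrA; congr (_ + _); rewrite addrC.
Qed.

Lemma btens_act1 m : btens_act 1 m = m.
Proof.
elim/btens_ind: m => [|d w n m IH]; first by rewrite raddf0.
by rewrite linearP /= IH btens_act_tens mul1r.
Qed.

Lemma btens_actM u v m : btens_act (u * v) m = btens_act u (btens_act v m).
Proof.
elim/btens_ind: m => [|d w n m IH]; first by rewrite !raddf0.
by rewrite !linearP /= IH !btens_act_tens mulrA.
Qed.

Lemma btens_act_comm u v m : btens_act (u * v - v * u) m =
  btens_act u (btens_act v m) - btens_act v (btens_act u m).
Proof.
by rewrite -scaleN1r addrC btens_act_linl scaleN1r addrC !btens_actM.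
Qed.

Lemma btens_act_tens1 x n : b x -> btens_act (j x) (tens 1 n) = tens 1 (rho x n).
Proof. by move=> bx; rewrite btens_act_tens -tens_bal // mul1r mulr1. Qed.

Lemma tens0 u : tens u 0 = 0.
Proof.
apply: (@addrI _ (tens u 0)); rewrite -[X in X + _]scale1r -tens_linr.
by rewrite scaler0 !addr0.
Qed.

End BalancedTensor.

(* U(L) (x)_{U(b)} N, for a Lie subalgebra b of L and a b-module N with action
   rho; only the restriction of rho to b is used.  As b generates the algebra
   U(b), balancing over b is the same as balancing over U(b). *)
Section Induction.
Variables (K : fieldType) (L : lieType K) (N : lmodType K).
Variables (b : L -> Prop) (rho : L -> N -> N).

Definition ind := btens (@env_in K L) b rho.
HB.instance Definition _ := GRing.Lmodule.on ind.

Definition ind_tens (u : env L) (n : N) : ind := tens _ _ _ u n.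

Definition ind_act (u : env L) (m : ind) : ind := btens_act u m.

End Induction.

Section VermaZero.
Variable K : fieldType.

Definition loop_sl2 := loop (sl2 K).
HB.instance Definition _ := Lie.on loop_sl2.

Definition loop_e (j : int) : loop_sl2 := tpow (sl2e K) j.
Definition loop_h (j : int) : loop_sl2 := tpow (sl2h K) j.
Definition loop_f (j : int) : loop_sl2 := tpow (sl2f K) j.

Definition Esub : loop_sl2 -> Prop := span (fun x => exists j, x = loop_e j).
Definition Hsub : loop_sl2 -> Prop := span (fun x => exists j, x = loop_h j).

Definition HEsub (x : loop_sl2) : Prop :=
  exists y z, [/\ Hsub y, Esub z & x = y + z].

Definition M0 := ind HEsub (fun (_ : loop_sl2) (_ : K^o) => 0).
HB.instance Definition _ := GRing.Lmodule.on M0.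

Definition u0 : M0 := ind_tens _ _ 1 1.

Definition act (x : loop_sl2) (v : M0) : M0 := ind_act (env_in x) v.

Lemma act_linear x : linear (act x).
Proof. exact: btens_act_is_linear. Qed.
HB.instance Definition _ x := GRing.isLinear.Build K M0 M0 _ (act x)
  (act_linear x).

Lemma act_linl v c x y : act (c *: x + y) v = c *: act x v + act y v.
Proof.
have -> : act (c *: x + y) v = ind_act (c *: env_in x + env_in y) v.
  by rewrite /act linearP.
exact: btens_act_linl.
Qed.

Lemma act_lie x y v : act [lie x, y] v = act x (act y v) - act y (act x v).
Proof.
have -> : act [lie x, y] v =
    ind_act (env_in x * env_in y - env_in y * env_in x) v.
  by rewrite /act env_in_lie.
exact: btens_act_comm.
Qed.

Lemma act_u0 x : HEsub x -> act x u0 = 0.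
Proof. by move=> bx; rewrite [LHS]btens_act_tens1 // tens0. Qed.

Definition layer (n : nat) (v : M0) : Prop :=
  act (loop_h 0) v = (- (2 * n)%:R) *: v.

Definition singular (v : M0) : Prop := forall x, Esub x -> act x v = 0.

(* The index i in {1, ..., n} is represented by i - 1 : 'I_n, whence the
   successor in s i. The product is taken in U(g) and applied to u0. *)
Definition wvec (n : nat) (chi : 'I_n -> int) : M0 :=
  \sum_(s : 'S_n) (-1) ^+ s *:
    ind_act (\prod_(i < n) env_in (loop_f (chi i + (s i).+1%:Z))) u0.

End VermaZero.

Arguments wvec K {n} chi.

(* Main.v *)
(* Expanding e(j) f(a_1) ... f(a_n) u_0 with the commutation relations leaves
   -2 times a sum, over pairs i < k, of monomials that depend on a_i and a_k
   only through a_i + a_k.  With a_i = chi_i + sigma(i), such a monomial is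
   unchanged when sigma is composed with the transposition (i k), while the
   sign changes, so the alternating sum over sigma cancels. *)
From HB Require Import structures.
Require Import Defs.
From mathcomp Require Import all_boot perm all_order all_algebra.

Set Implicit Arguments.
Unset Strict Implicit.
Unset Printing Implicit Defensive.

Import GRing.Theory.
Local Open Scope ring_scope.

Section LoopAction.
Variable K : fieldType.
Implicit Types (v : M0 K) (j k : int).

Lemma act0l v : act 0 v = 0.
Proof. by have := act_linl v (-1) 0 0; rewrite scaler0 addr0 scaleN1r addNr. Qed.

Lemma actZl c x v : act (c *: x) v = c *: act x v.
Proof. by have := act_linl v c x 0; rewrite addr0 act0l addr0. Qed.

Lemma act_e_u0 j : act (loop_e K j) (u0 K) = 0.
Proof.
apply: act_u0; exists 0, (loop_e K j); split; first exact: span0.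
  by apply: span_gen; exists j.
by rewrite add0r.
Qed.

Lemma act_h_u0 j : act (loop_h K j) (u0 K) = 0.
Proof.
apply: act_u0; exists (loop_h K j), 0; split; last by rewrite addr0.
  by apply: span_gen; exists j.
exact: span0.
Qed.

Lemma act_ef j k v : act (loop_e K j) (act (loop_f K k) v) =
  act (loop_h K (j + k)) v + act (loop_f K k) (act (loop_e K j) v).
Proof.
have -> : loop_h K (j + k) = [lie loop_e K j, loop_f K k].
  by rewrite /loop_h -sl2_lie_ef -lie_tpow.
by rewrite act_lie subrK.
Qed.

Lemma act_hf j k v : act (loop_h K j) (act (loop_f K k) v) =
  (- 2) *: act (loop_f K (j + k)) v + act (loop_f K k) (act (loop_h K j) v).
Proof.
rewrite -actZl.
have <- : [lie loop_h K j, loop_f K k] = (- 2) *: loop_f K (j + k) :> loop_sl2 K.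
  by rewrite /loop_f -tpowZ -sl2_lie_hf -lie_tpow.
by rewrite act_lie subrK.
Qed.

Section Monomials.
Variable I : eqType.
Implicit Types (a b : I -> int) (s : seq I).

(** Indexing by a list allows a monomial to be cut at any factor, which is how [e] and [h] are moved
    through it. *)
Definition fmon a s v : M0 K :=
  foldr (fun i => act (loop_f K (a i))) v s.

Lemma fmon_is_linear a s : linear (fmon a s).
Proof. by move=> c v w; elim: s => //= i s ->; rewrite linearP. Qed.
HB.instance Definition _ a s :=
  GRing.isLinear.Build K (M0 K) (M0 K) _ (fmon a s) (fmon_is_linear a s).

Lemma fmon_rcons a s i v :
  fmon a (rcons s i) v = fmon a s (act (loop_f K (a i)) v).
Proof. exact: foldr_rcons. Qed.

Lemma eq_in_fmon a b s v : {in s, a =1 b} -> fmon a s v = fmon b s v.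
Proof.
elim: s => [//|i s IH] ab /=.
rewrite (ab i (mem_head _ _)) IH => [//|k sk].
by apply: ab; rewrite inE sk orbT.
Qed.

Lemma ind_act_prod a s v :
  ind_act (\prod_(i <- s) env_in (loop_f K (a i))) v = fmon a s v.
Proof.
elim: s => [|i s IH]; first by rewrite big_nil; exact: btens_act1.
by rewrite big_cons /= -IH; exact: btens_actM.
Qed.

(** Moving [h(0)] past each factor contributes weight -2, and [u0] has weight 0. *)
Lemma act_h0_fmon a s :
  act (loop_h K 0) (fmon a s (u0 K)) = - (2 * size s)%:R *: fmon a s (u0 K).
Proof.
elim: s => [|i s IH] /=; first by rewrite act_h_u0 muln0 oppr0 scale0r.
rewrite act_hf IH add0r linearZ /= -scalerDl -opprD mulnS natrD.
by congr (- _ *: _).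
Qed.

End Monomials.

Section AlternatingSum.
Variables (n : nat) (chi : 'I_n -> int).
Implicit Types (s : 'S_n) (p q : seq 'I_n) (i : 'I_n).

Let a s i : int := chi i + (s i).+1%:Z.

(** Reindexing by the odd permutation [tperm i k] turns the sum into its opposite. The factor 2 is
    later supplied by the -2 in [act_hf]. *)
Lemma altsum_swap (G : 'S_n -> M0 K) (i k : 'I_n) : i != k ->
  (forall s, G (tperm i k * s)%g = G s) ->
  (2 : K) *: (\sum_(s : 'S_n) (-1) ^+ s *: G s) = 0.
Proof.
move=> neq_ik Gik; rewrite -[2]/(1 + 1) scalerDl scale1r.
rewrite [X in X + _](reindex_inj (mulgI (tperm i k))) -big_split /=.
apply: big1 => s _; rewrite Gik odd_permM odd_tperm neq_ik signr_addb expr1.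
by rewrite mulN1r scaleNr addNr.
Qed.

(** Uniqueness keeps [i] and [k] out of [p] and [q], so the transposition fixes the outer factors,
    and the merged index is symmetric. *)
Lemma altsum_merge j p (i k : 'I_n) q : uniq (i :: k :: p ++ q) ->
  (2 : K) *: (\sum_(s : 'S_n) (-1) ^+ s *: fmon (a s) p
    (act (loop_f K (j + a s i + a s k)) (fmon (a s) q (u0 K)))) = 0.
Proof.
rewrite /= inE mem_cat !negb_or -!andbA mem_cat negb_or.
case/and5P=> nik nip niq /andP[nkp nkq] _.
apply: altsum_swap nik _ => s.
have a_swap (r : seq 'I_n) : i \notin r -> k \notin r ->
    {in r, a (tperm i k * s)%g =1 a s}.
  move=> nir nkr l rl; rewrite /a permM tpermD //.
    by apply: contraNneq nir => ->.
  by apply: contraNneq nkr => ->.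
rewrite (eq_in_fmon _ (a_swap p nip nkp)) (eq_in_fmon _ (a_swap q niq nkq)).
have -> // : j + a (tperm i k * s)%g i + a (tperm i k * s)%g k = j + a s i + a s k.
(* The transposition acts before [s]: it exchanges [s i] and [s k] but leaves [chi i] and [chi k] in
   place. *)
rewrite /a !permM tpermL tpermR -!addrA; congr (_ + (_ + _)).
by rewrite addrCA [RHS]addrCA [X in _ + X]addrC.
Qed.

(** As [h] moves right, [p] collects the factors already passed. Crossing factor [k] leaves a merged
    term, killed by [altsum_merge]; at the end [h] kills [u0]. *)
Lemma altsum_h j p i q : uniq (i :: p ++ q) ->
  \sum_(s : 'S_n) (-1) ^+ s *: fmon (a s) p
    (act (loop_h K (j + a s i)) (fmon (a s) q (u0 K))) = 0.
Proof.
elim: q p => [|k q IH] p uniq_ipq.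
  by apply: big1 => s _; rewrite act_h_u0 linear0 scaler0.
have step (s : 'S_n) : (-1) ^+ s *: fmon (a s) p
      (act (loop_h K (j + a s i)) (fmon (a s) (k :: q) (u0 K))) =
    (- 2) *: ((-1) ^+ s *: fmon (a s) p
      (act (loop_f K (j + a s i + a s k)) (fmon (a s) q (u0 K)))) +
    (-1) ^+ s *: fmon (a s) (rcons p k)
      (act (loop_h K (j + a s i)) (fmon (a s) q (u0 K))).
  rewrite [fmon _ (k :: q) _]/= act_hf.
  rewrite (fmon_is_linear (a s) p (- 2)) fmon_rcons [LHS]scalerDr.
  by rewrite !scalerA [- 2 * _]mulrC.
have uniq_ikpq : uniq (i :: k :: p ++ q).
  rewrite -(@perm_uniq _ (i :: p ++ k :: q)) // perm_cons.
  exact/permPl/(perm_catCA p [:: k]).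
rewrite (eq_bigr _ (fun s _ => step s)) big_split /=.
rewrite [X in _ + X]IH; last by rewrite cat_rcons.
(* Only the sign is split off -2, leaving exactly the doubled sum of [altsum_merge]. *)
rewrite addr0 -scaler_sumr scaleNr.
by rewrite (altsum_merge j uniq_ikpq) oppr0.
Qed.

(** The same sweep for [e]: crossing factor [i] leaves [h(j + a_i)] in its place, which [altsum_h]
    handles with [i] removed from the list. *)
Lemma altsum_e j p q : uniq (p ++ q) ->
  \sum_(s : 'S_n) (-1) ^+ s *: fmon (a s) p
    (act (loop_e K j) (fmon (a s) q (u0 K))) = 0.
Proof.
elim: q p => [|i q IH] p uniq_pq.
  by apply: big1 => s _; rewrite act_e_u0 linear0 scaler0.
have step (s : 'S_n) : (-1) ^+ s *: fmon (a s) p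
      (act (loop_e K j) (fmon (a s) (i :: q) (u0 K))) =
    (-1) ^+ s *: fmon (a s) p
      (act (loop_h K (j + a s i)) (fmon (a s) q (u0 K))) +
    (-1) ^+ s *: fmon (a s) (rcons p i)
      (act (loop_e K j) (fmon (a s) q (u0 K))).
  by rewrite [fmon _ (i :: q) _]/= act_ef raddfD fmon_rcons [LHS]scalerDr.
have uniq_ipq : uniq (i :: p ++ q).
  rewrite -(@perm_uniq _ (p ++ i :: q)) //.
  exact/permPl/(perm_catCA p [:: i]).
rewrite (eq_bigr _ (fun s _ => step s)) big_split /=.
rewrite [X in _ + X]IH; last by rewrite cat_rcons.
by rewrite (altsum_h j uniq_ipq) addr0.
Qed.

Lemma wvecE :
  wvec K chi = \sum_(s : 'S_n) (-1) ^+ s *: fmon (a s) (index_enum 'I_n) (u0 K).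
Proof.
by apply: eq_bigr => s _; rewrite -ind_act_prod.
Qed.

End AlternatingSum.

End LoopAction.

Theorem theorem19 (K : fieldType) (K_char0 : [pchar K] =i pred0)
    (n : nat) (n_gt0 : (0 < n)%N) (chi : 'I_n -> int) :
  layer n (wvec K chi) /\ singular (wvec K chi).
Proof.
rewrite wvecE; split.
  have size_n : size (index_enum 'I_n) = n.
    by rewrite [index_enum _]unlock -enumT size_enum_ord.
  rewrite /layer linear_sum scaler_sumr; apply: eq_bigr => s _.
  by rewrite linearZ /= act_h0_fmon size_n !scalerA mulrC.
(* The action is linear in [x], so induction on the span reduces to a single [e(j)]. *)
move=> x; elim=> [|c _ y [j ->] _ IH]; first exact: act0l.
rewrite act_linl IH addr0 linear_sum /=.
under eq_bigr => s _ do rewrite linearZ /=.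
(* The sweep starts with [e(j)] to the left of all factors, hence the empty prefix. *)
by rewrite (altsum_e K chi j (p := [::])) ?index_enum_uniq // scaler0.
Qed.
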